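(* Let $Q\subset\mathbb{R}^n$ be convex and closed, and let $f:\mathbb{R}^n\to\mathbb{R}$ be a convex, $M$-Lipschitz, positively homogeneous (of degree 1) function with $0\in\operatorname{int}\partial f(0)$ and $f^*=\min_{x\in Q}f(x)>0$, such that $\gamma_0\|x\|_2\le f(x)$ for all $x\in Q$ with some $\gamma_0>0$. Let $X_*$ be the set of minimizers of $f$ on $Q$ and suppose that for some $\alpha\in(0,M)$ $$f(x)-f^*\ge\alpha\min_{x_*\in X_*}\|x-x_*\|_2\qquad\forall x\in Q.$$ Let $x_0\in Q$ satisfy $\|x_0\|_2=\min_{x\in Q}\|x\|_2$, and let $$x_{k+1}=Pr_Q\{x_k-h_k\nabla f(x_k)\},\qquad h_k=\frac{f(x_k)-f^*}{M\|\nabla f(x_k)\|_2},\qquad k\ge0 .$$ Then for every sufficiently small $\gamma>0$, after $$k\ge\frac{2(\ln 2M-\ln\gamma\gamma_0)}{\ln M^2-\ln(M^2-\alpha^2)}-1$$ iterations one has $$f(x_{k+1})\le(1+\gamma)f^* .$$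
   Context: $\|\cdot\|_2$ is the Euclidean norm, $Pr_Q$ the Euclidean projection onto $Q$, and $\nabla f(x)$ an arbitrary subgradient of the convex function $f$ at $x$. $M$-Lipschitz means $|f(x)-f(y)|\le M\|x-y\|_2$. *)

(* Defs.v *)
From mathcomp Require Import all_boot all_order all_algebra.
From mathcomp Require Import all_classical all_reals all_analysis.
Import Order.TTheory GRing.Theory Num.Theory.
Import numFieldNormedType.Exports.

Set Implicit Arguments.
Unset Strict Implicit.
Unset Printing Implicit Defensive.

Local Open Scope classical_set_scope.
Local Open Scope ring_scope.

Definition dotv (R : realType) (n : nat) (u v : 'rV[R]_n) : R :=
  \sum_(i < n) u 0 i * v 0 i.

(* The library's norm `|x| on row vectors is the sup norm. It induces the same
   topology, so the library's closed and interior are the Euclidean ones. *)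
Definition norm2 (R : realType) (n : nat) (u : 'rV[R]_n) : R :=
  Num.sqrt (dotv u u).

Definition is_min (R : realType) (A : set R) (m : R) : Prop :=
  A m /\ lbound A m.

Definition argmin_on (R : realType) (n : nat) (Q : set 'rV[R]_n)
    (f : 'rV[R]_n -> R) : set 'rV[R]_n :=
  [set x | Q x /\ forall y, Q y -> f x <= f y].

(* p = Pr_Q(y), stated as a relation. *)
Definition is_proj (R : realType) (n : nat) (Q : set 'rV[R]_n)
    (y p : 'rV[R]_n) : Prop :=
  argmin_on Q (fun q => norm2 (y - q)) p.

Definition subdifferential (R : realType) (n : nat) (f : 'rV[R]_n -> R)
    (x : 'rV[R]_n) : set 'rV[R]_n :=
  [set g | forall y, f x + dotv g (y - x) <= f y].

Definition lipschitz2 (R : realType) (n : nat) (M : R)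
    (f : 'rV[R]_n -> R) : Prop :=
  forall x y, `|f x - f y| <= M * norm2 (x - y).

Definition pos_homogeneous (R : realType) (n : nat)
    (f : 'rV[R]_n -> R) : Prop :=
  forall (t : R) (x : 'rV[R]_n), 0 < t -> f (t *: x) = t * f x.

(* Main.v *)
(* Let d_k be the distance from x_k to the nearest minimizer p. Since p is
   feasible, projecting onto Q does not increase the distance to p, and the
   subgradient inequality <g_k, x_k - p> >= f(x_k) - f^* together with
   |g_k| <= M gives, for the chosen step,
     d_(k+1)^2 <= d_k^2 - (f(x_k) - f^* )^2 / M^2 <= (1 - alpha^2/M^2) d_k^2,
   the last step by sharpness. The initial distance is at most 2 f^* / gamma0
   because |x_0| <= |p| <= f^* / gamma0, so
     f(x_(k+1)) - f^* <= M d_(k+1)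
                      <= (2 M / gamma0) (1 - alpha^2/M^2)^((k+1)/2) f^*,
   and the bound on k makes the coefficient of f^* at most gamma. *)

Require Import Defs.
From mathcomp Require Import all_boot all_order all_algebra.
From mathcomp Require Import all_classical all_reals all_analysis.
From mathcomp Require Import ring lra.
Import Order.TTheory GRing.Theory Num.Theory.
Import numFieldNormedType.Exports.

Set Implicit Arguments.
Unset Strict Implicit.
Unset Printing Implicit Defensive.

Local Open Scope classical_set_scope.
Local Open Scope ring_scope.

(** * Euclidean inner product and norm *)

Section EuclideanSpace.
Context {R : realType} {n : nat}.
Implicit Types (u v w x y p q : 'rV[R]_n) (S : set 'rV[R]_n).

Lemma dotvC u v : dotv u v = dotv v u.
Proof. by apply: eq_bigr => i _; rewrite mulrC. Qed.

Lemma dotvDl u v w : dotv (u + v) w = dotv u w + dotv v w.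
Proof. by rewrite -big_split; apply: eq_bigr => i _; rewrite mxE mulrDl. Qed.

Lemma dotvZl t u v : dotv (t *: u) v = t * dotv u v.
Proof. by rewrite [RHS]mulr_sumr; apply: eq_bigr => i _; rewrite mxE mulrA. Qed.

Lemma dot0v u : dotv 0 u = 0.
Proof. by rewrite /dotv big1// => i _; rewrite mxE mul0r. Qed.

Lemma dotvNl u v : dotv (- u) v = - dotv u v.
Proof. by rewrite -scaleN1r dotvZl mulN1r. Qed.

Lemma dotvDr u v w : dotv u (v + w) = dotv u v + dotv u w.
Proof. by rewrite dotvC dotvDl !(dotvC u). Qed.

Lemma dotvZr t u v : dotv u (t *: v) = t * dotv u v.
Proof. by rewrite dotvC dotvZl dotvC. Qed.

Lemma dotvNr u v : dotv u (- v) = - dotv u v.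
Proof. by rewrite dotvC dotvNl dotvC. Qed.

Definition dotvE := (dotvDl, dotvDr, dotvNl, dotvNr, dotvZl, dotvZr).

Lemma dotvv_ge0 u : 0 <= dotv u u.
Proof. by apply: sumr_ge0 => i _; rewrite -expr2 sqr_ge0. Qed.

Lemma norm2_ge0 u : 0 <= norm2 u.
Proof. exact: sqrtr_ge0. Qed.

Lemma sqr_norm2 u : norm2 u ^+ 2 = dotv u u.
Proof. by rewrite sqr_sqrtr// dotvv_ge0. Qed.

Lemma norm2_le u v : (norm2 u <= norm2 v) = (dotv u u <= dotv v v).
Proof. by rewrite ler_sqrt// dotvv_ge0. Qed.

Lemma norm20 : norm2 (0 : 'rV[R]_n) = 0.
Proof. by rewrite /norm2 dot0v sqrtr0. Qed.

Lemma coord_le_norm2 u i : `|u 0 i| <= norm2 u.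
Proof.
rewrite -sqrtr_sqr ler_wsqrtr// /dotv (bigD1 i)//= -expr2 lerDl.
by apply: sumr_ge0 => j _; rewrite -expr2 sqr_ge0.
Qed.

Lemma norm2_eq0 u : norm2 u = 0 -> u = 0.
Proof.
move=> u0; apply/rowP => i; rewrite mxE; apply/eqP.
by rewrite -normr_le0 -u0 coord_le_norm2.
Qed.

(** Library boundedness uses the sup norm; this comparison makes Euclidean balls bounded in that
    sense. *)
Lemma mx_norm_le_norm2 u : `|u| <= norm2 u.
Proof.
rewrite [leLHS]/Num.norm/= mx_normrE; apply/bigmax_leP; split.
  exact: norm2_ge0.
by move=> [i j] _ /=; rewrite ord1 coord_le_norm2.
Qed.

(** * Continuity and existence of nearest points *)

Lemma norm2_continuous : continuous (@norm2 R n).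
Proof.
move=> u; apply: continuous_comp; last exact: sqrt_continuous.
apply: continuous_big => [|i _ v]; first exact: add_continuous.
by apply: continuousM; exact: (@coord_continuous R 1 n 0 i).
Qed.

Lemma dist2_continuous y : continuous (fun q => norm2 (y - q)).
Proof.
move=> q; apply: continuous_comp; last exact: norm2_continuous.
by apply: continuousB => //; exact: cst_continuous.
Qed.

Lemma lipschitz2_continuous M (f : 'rV[R]_n -> R) :
  lipschitz2 M f -> continuous f.
Proof.
move=> fM x; apply/(@cvgrPdist_lt _ R^o _ _ (nbhs_filter x)) => e e_gt0.
have : {for x, continuous (fun y => M * norm2 (x - y))}.
  by apply: continuousM; [exact: cst_continuous|exact: dist2_continuous].
rewrite /prop_for /continuous_at subrr norm20 mulr0 => dist0.
near=> y; apply: (le_lt_trans (fM x y)); near: y.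
exact: cvgr_lt dist0 _ e_gt0.
Unshelve. all: by end_near. Qed.

(** Cutting [S] by the closed Euclidean ball around [y] through a known point [q0] leaves a compact
    set, where the distance attains its minimum; points outside the ball are farther than [q0]. *)
Lemma is_proj_exists S y : closed S -> S !=set0 -> exists p, is_proj S y p.
Proof.
move=> Scl [q0 Sq0].
pose K := S `&` (fun q => norm2 (y - q)) @^-1` [set r | r <= norm2 (y - q0)].
have Kcpt : compact K.
  apply: bounded_closed_compact; last first.
    apply: closedI => //; apply: preimage_closed; last exact: closed_le.
    by move=> q _; exact: dist2_continuous.
  exists (`|y| + norm2 (y - q0)); split; first exact: num_real.
  move=> t ltt q [_ /= qK]; apply/ltW/(le_lt_trans _ ltt).
  rewrite -[q in `|q|](subKr y); apply: (le_trans (ler_normB _ _)).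
  by rewrite lerD2l (le_trans (mx_norm_le_norm2 _)).
have dist_cont := continuous_subspaceT (@dist2_continuous y).
have [|p + pmin] := EVT_min_rV _ Kcpt (dist_cont _).
  by exists q0; split => //=.
rewrite inE => -[Sp /= pq0]; exists p; split => // q Sq.
have [qq0|/ltW q0q] := leP (norm2 (y - q)) (norm2 (y - q0)).
  by apply: pmin; rewrite inE.
exact: le_trans pq0 q0q.
Qed.

(** * Projections onto convex sets, subgradients and the set of minimizers *)

Lemma convex_set_segment S p q t : convex_set S -> S p -> S q ->
  0 <= t <= 1 -> S (p + t *: (q - p)).
Proof.
move=> cS Sp Sq t01.
have := cS q p (Itv01 (andP t01).1 (andP t01).2).
rewrite !inE => /(_ Sq Sp); congr S.
by rewrite /conv/= [X in _ + X]scalerBl scale1r scalerBr addrCA.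
Qed.

(** Moving from [p] towards [q] by a fraction [t] changes the squared distance to [y] by -2ta + t^2
    b, with a = <y - p, q - p> and b = |q - p|^2. If a > 0, a small [t] contradicts minimality. *)
Lemma is_proj_dotv_le0 S y p q : convex_set S -> is_proj S y p -> S q ->
  dotv (y - p) (q - p) <= 0.
Proof.
move=> cS [Sp pmin] Sq; rewrite leNgt; apply/negP => a_gt0.
set a := dotv _ _ in a_gt0; pose b := dotv (q - p) (q - p).
have b_ge0 : 0 <= b := dotvv_ge0 _.
(* Since t(a + b) = a, the change equals -ta(1 + t) < 0. *)
pose t := a / (a + b).
have ab_gt0 : 0 < a + b by lra.
have t_gt0 : 0 < t by exact: divr_gt0.
have t_le1 : t <= 1 by rewrite ler_pdivrMr//; lra.
have tb : t * (a + b) = a by rewrite divfK// gt_eqF.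
have ta_gt0 : 0 < t * a by exact: mulr_gt0.
have t01 : 0 <= t <= 1 by rewrite ltW.
have := pmin _ (convex_set_segment cS Sp Sq t01).
rewrite norm2_le opprD addrA !(dotvDl (y - p)) !(dotvDr _ (y - p)).
rewrite !(dotvNl, dotvNr, dotvZl, dotvZr) (dotvC (q - p) (y - p)) -/a -/b.
nra.
Qed.

(** Expand |y - q|^2 = |y - p|^2 + |p - q|^2 - 2<y - p, q - p>. *)
Lemma is_proj_contract S y p q : convex_set S -> is_proj S y p -> S q ->
  dotv (p - q) (p - q) <= dotv (y - q) (y - q).
Proof.
move=> cS pP Sq; have := is_proj_dotv_le0 cS pP Sq; have := dotvv_ge0 (y - p).
by rewrite !dotvE (dotvC p y) (dotvC q y) (dotvC q p); lra.
Qed.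

(** Testing the subgradient inequality at [x + g] gives |g|^2 <= f(x + g) - f(x) <= M|g|. *)
Lemma subgradient_norm2_le M (f : 'rV[R]_n -> R) x g :
  lipschitz2 M f -> subdifferential f x g -> g != 0 -> norm2 g <= M.
Proof.
move=> fM gx g0; have N_gt0 : 0 < norm2 g.
  rewrite lt_neqAle norm2_ge0 andbT eq_sym.
  by apply: contra_neq g0; exact: norm2_eq0.
rewrite -(ler_pM2r N_gt0) -expr2 sqr_norm2.
have := gx (x + g); have := fM (x + g) x.
by rewrite (addrC x) addrK => /(le_trans (ler_norm _)); lra.
Qed.

Lemma closed_argmin_on S (f : 'rV[R]_n -> R) :
  closed S -> continuous f -> closed (argmin_on S f).
Proof.
move=> Scl fc.
rewrite (_ : argmin_on S f =
             S `&` \bigcap_(y in S) f @^-1` [set r | r <= f y]).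
  apply: closedI => //; apply: closed_bigI => y _.
  by apply: preimage_closed; [move=> q _; exact: fc|exact: closed_le].
by apply/seteqP; split.
Qed.

End EuclideanSpace.

(** Here D = |x - p|^2, F = f(x) - f^*, N = |g| and a = <g, x - p>, so the left side is |x - hg -
    p|^2. As hN = F/M and h >= F/M^2, it is at most D - F^2/M^2. *)
Lemma subgradient_step_contract (R : realFieldType) (D F N M a alpha h : R) :
  0 < N -> N <= M -> 0 <= F -> F <= a -> alpha ^+ 2 * D <= F ^+ 2 ->
  h = F / (M * N) ->
  D - 2 * h * a + h ^+ 2 * N ^+ 2 <= (1 - alpha ^+ 2 / M ^+ 2) * D.
Proof.
move=> N_gt0 NM F_ge0 Fa FD hE; have M_gt0 : 0 < M by lra.
have hN : h * N = F / M by rewrite hE; field; rewrite !gt_eqF.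
have h_ge : F / M ^+ 2 <= h.
  rewrite hE ler_wpM2l// lef_pV2 ?posrE ?mulr_gt0 ?exprn_gt0//.
  by rewrite expr2 ler_pM2l.
have ha : F / M ^+ 2 * F <= h * a.
  by apply: ler_pM => //; rewrite divr_ge0 ?sqr_ge0.
have : alpha ^+ 2 * D / M ^+ 2 <= F ^+ 2 / M ^+ 2.
  by rewrite ler_wpM2r// invr_ge0 sqr_ge0.
rewrite -exprMn hN expr_div_n.
rewrite mulrAC -expr2 in ha.
have -> : (1 - alpha ^+ 2 / M ^+ 2) * D = D - alpha ^+ 2 * D / M ^+ 2.
  by rewrite mulrBl mul1r mulrAC.
lra.
Qed.

(** Take logarithms: the base has logarithm -L, where L > 0 is the denominator in the bound on [k],
    and that bound says (k + 1)L >= 2 ln(b/c). *)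
Lemma geometric_le_sqr (R : realType) (a M b c : R) (k : nat) :
  0 < a -> a < M -> 0 < b -> 0 < c ->
  2 * (ln b - ln c) / (ln (M ^+ 2) - ln (M ^+ 2 - a ^+ 2)) - 1 <= k%:R ->
  (1 - a ^+ 2 / M ^+ 2) ^+ k.+1 <= (c / b) ^+ 2.
Proof.
move=> a_gt0 aM b_gt0 c_gt0.
have M2_gt0 : 0 < M ^+ 2 by rewrite exprn_gt0// (lt_trans a_gt0).
have a2_gt0 : 0 < a ^+ 2 by rewrite exprn_gt0.
have Ma_gt0 : 0 < M ^+ 2 - a ^+ 2 by nra.
have L_gt0 : 0 < ln (M ^+ 2) - ln (M ^+ 2 - a ^+ 2).
  by rewrite subr_gt0 ltr_ln ?posrE//; lra.
have qE : 1 - a ^+ 2 / M ^+ 2 = (M ^+ 2 - a ^+ 2) / M ^+ 2.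
  by rewrite mulrBl divff ?gt_eqF.
have q_gt0 : 0 < (M ^+ 2 - a ^+ 2) / M ^+ 2 by exact: divr_gt0.
have cb_gt0 : 0 < c / b by exact: divr_gt0.
rewrite lerBlDr ler_pdivrMr// natr1 => kL.
rewrite qE -ler_ln ?posrE ?exprn_gt0// !lnXn// !ln_div ?posrE//.
by rewrite -mulr_natr -[leRHS]mulr_natr; lra.
Qed.

Theorem mainTheorem7 (R : realType) (n : nat)
    (Q : set 'rV[R]_n) (f : 'rV[R]_n -> R) (M gamma0 alpha fstar : R)
    (Q_convex : convex_set Q) (Q_closed : closed Q)
    (f_convex : convex_function [set: 'rV[R]_n] f)
    (f_lipschitz : lipschitz2 M f)
    (f_homogeneous : pos_homogeneous f)
    (f_subdiff0 : interior (subdifferential f 0) 0)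
    (fstar_min : is_min (f @` Q) fstar) (fstar_gt0 : 0 < fstar)
    (gamma0_gt0 : 0 < gamma0)
    (f_lower : forall x, Q x -> gamma0 * norm2 x <= f x)
    (alpha_gt0 : 0 < alpha) (alpha_ltM : alpha < M)
    (f_sharp : forall x d, Q x ->
       is_min [set norm2 (x - xs) | xs in argmin_on Q f] d ->
       alpha * d <= f x - fstar) :
  exists2 gamma_max : R, 0 < gamma_max &
    forall gamma : R, 0 < gamma -> gamma < gamma_max ->
    forall (x g : nat -> 'rV[R]_n) (h : nat -> R),
      Q (x 0%N) -> is_min [set norm2 y | y in Q] (norm2 (x 0%N)) ->
      (forall k, subdifferential f (x k) (g k)) ->
      (forall k, h k = (f (x k) - fstar) / (M * norm2 (g k))) ->
      (forall k, is_proj Q (x k - h k *: g k) (x k.+1)) ->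
    forall k : nat,
      2 * (ln (2 * M) - ln (gamma * gamma0))
        / (ln (M ^+ 2) - ln (M ^+ 2 - alpha ^+ 2)) - 1 <= k%:R ->
      f (x k.+1) <= (1 + gamma) * fstar.
Proof.
have M_gt0 : 0 < M by exact: lt_trans alpha_gt0 _.
(* Homogeneity with factor 2 gives f(0) = 2f(0). *)
have f0 : f 0 = 0.
  by have := f_homogeneous 2 0 (ltr0Sn _ 1); rewrite scaler0; lra.
have [[xm Qxm fxm] fstar_le] := fstar_min.
have Q_ge x : Q x -> fstar <= f x by move=> Qx; apply: fstar_le; exists x.
have f_argmin p : argmin_on Q f p -> f p = fstar.
  by move=> [Qp pmin]; apply/eqP; rewrite eq_le Q_ge// -fxm pmin.
have nearest x : exists p, is_proj (argmin_on Q f) x p.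
  apply: is_proj_exists; last by exists xm; split=> // y Qy; rewrite fxm Q_ge.
  exact: closed_argmin_on (lipschitz2_continuous f_lipschitz).
(* The threshold 1 is an arbitrary positive choice. *)
exists 1 => // gamma gamma_gt0 _ x g h Qx0 x0min gx hE xP k kge.
pose q := 1 - alpha ^+ 2 / M ^+ 2; pose C := 2 * (fstar / gamma0).
have Qx j : Q (x j) by case: j => [//|j]; exact: (xP j).1.
have step j p : is_proj (argmin_on Q f) (x j) p ->
    dotv (x j.+1 - p) (x j.+1 - p) <= q * dotv (x j - p) (x j - p).
  move=> [p_argmin pmin]; have Qp := p_argmin.1.
  apply: (le_trans (is_proj_contract Q_convex (xP j) Qp)).
  (* A zero subgradient would make [x j] a global minimizer, so f(x_j) <= f(0) = 0, against f(x_j)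
     >= f^* > 0. Hence the step size never divides by zero. *)
  have g_neq0 : g j != 0.
    apply/eqP => gj0; have := gx j 0; rewrite gj0 dot0v f0.
    by have := Q_ge _ (Qx j); lra.
  have N_gt0 : 0 < norm2 (g j).
    rewrite lt_neqAle norm2_ge0 andbT eq_sym.
    by apply: contra_neq g_neq0; exact: norm2_eq0.
  have NM := subgradient_norm2_le f_lipschitz (gx j) g_neq0.
  have F_ge0 : 0 <= f (x j) - fstar by rewrite subr_ge0 Q_ge.
  have Fa : f (x j) - fstar <= dotv (g j) (x j - p).
    by have := gx j p; rewrite -(opprB (x j)) dotvNr (f_argmin p)//; lra.
  have FD : alpha ^+ 2 * dotv (x j - p) (x j - p) <= (f (x j) - fstar) ^+ 2.
    rewrite -sqr_norm2 -exprMn.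
    rewrite ler_sqr ?nnegrE ?mulr_ge0 ?norm2_ge0 ?(ltW alpha_gt0)//.
    apply: f_sharp => //; split; first by exists p.
    by move=> _ [y y_argmin <-]; exact: pmin.
  have := subgradient_step_contract N_gt0 NM F_ge0 Fa FD (hE j).
  rewrite -/q sqr_norm2 (addrAC (x j)) (dotvDl (x j - p)) !(dotvDr _ (x j - p)).
  by rewrite !(dotvNl, dotvNr, dotvZl, dotvZr) (dotvC _ (g j)); lra.
have dist j : exists2 p, argmin_on Q f p &
    dotv (x j - p) (x j - p) <= q ^+ j * C ^+ 2.
  elim: j => [|j [p p_argmin le_p]].
    have [p [p_argmin _]] := nearest (x 0%N); exists p => //.
    have Np : norm2 p <= fstar / gamma0.
      rewrite ler_pdivlMr// mulrC -(f_argmin _ p_argmin).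
      by apply: f_lower; case: p_argmin.
    have x0p : norm2 (x 0%N) <= norm2 p.
      by apply: x0min.2; exists p => //; case: p_argmin.
    have p2 : dotv p p <= (fstar / gamma0) ^+ 2.
      by rewrite -sqr_norm2 ler_sqr// nnegrE ?norm2_ge0// divr_ge0// ltW.
    (* From |x_0 + p|^2 >= 0 follows |x_0 - p|^2 <= 2|x_0|^2 + 2|p|^2 <= 4|p|^2 <= C^2. *)
    rewrite norm2_le in x0p; have := dotvv_ge0 (x 0%N + p).
    by rewrite expr0 mul1r exprMn !dotvE (dotvC p); lra.
  (* Sharpness concerns the nearest minimizer, so [p] is replaced by the one nearest to [x j], which
     is no farther from [x j] than [p]. *)
  have [p' p'P] := nearest (x j); exists p'; first by case: p'P.
  apply: (le_trans (step _ _ p'P)); rewrite exprS -mulrA ler_wpM2l//.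
    rewrite subr_ge0 ler_pdivrMr ?exprn_gt0// mul1r.
    by rewrite ler_sqr ?nnegrE ltW.
  by apply: le_trans le_p; rewrite -norm2_le; case: p'P => _; exact.
have [p p_argmin le_p] := dist k.+1.
have gg_gt0 : 0 < gamma * gamma0 by exact: mulr_gt0.
have M2_gt0 : 0 < 2 * M by exact: mulr_gt0.
have qk := geometric_le_sqr alpha_gt0 alpha_ltM M2_gt0 gg_gt0 kge.
have Mp : M * norm2 (x k.+1 - p) <= gamma * fstar.
  have ge0 := (ltW M_gt0, ltW gamma_gt0, ltW fstar_gt0).
  rewrite -ler_sqr ?nnegrE ?mulr_ge0 ?norm2_ge0 ?ge0// exprMn sqr_norm2.
  apply: (@le_trans _ _ (M ^+ 2 * ((gamma * gamma0 / (2 * M)) ^+ 2 * C ^+ 2))).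
    rewrite ler_wpM2l ?sqr_ge0//; apply: (le_trans le_p).
    by rewrite ler_wpM2r ?sqr_ge0.
  (* The constants cancel exactly: M * (gamma gamma0 / (2M)) * (2 f^* / gamma0) = gamma f^*. *)
  rewrite le_eqVlt; apply/orP; left; apply/eqP; rewrite /C; field.
  by rewrite !gt_eqF.
have := le_trans (ler_norm _) (f_lipschitz (x k.+1) p).
by rewrite (f_argmin p)//; lra.
Qed.
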